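(* Let $f\in\Gamma_0(X)$ with $Y\cap\operatorname{dom}f^*\neq\varnothing$ and let $d=d_f\in Y$ be the vector defined in the context. Then the following statements are equivalent for every $z\in\operatorname{argmin} f$: (i) $z=\operatorname{Prox}_f Rz$. (ii) $f^*(Sz)+\frac12\|Sz\|^2+f(z)=0$. (iii) $Sz=d$.
   Context: $X$ is a real Hilbert space with inner product $\langle\cdot,\cdot\rangle$ and norm $\|\cdot\|$. $m\in\{1,2,\dots\}$ and $R:X\to X$ is a linear isometry with $R^m=\mathrm{Id}$. $\operatorname{Fix}R=\{x: Rx=x\}$, $Y=(\operatorname{Fix}R)^\perp$, $S=R-\mathrm{Id}$, $Q=\frac1m\sum_{i=1}^{m-1}iR^i$. $\Gamma_0(X)$ is the set of proper lower semicontinuous convex functions $X\to\,]-\infty,+\infty]$. $f^*(x^* )=\sup_{x\in X}(\langle x,x^*\rangle-f(x))$ is the Fenchel conjugate; $\operatorname{dom}f=\{f<+\infty\}$; $\operatorname{argmin}f$ is the (possibly empty) set of minimizers of $f$ over $X$; $\partial f$ is the convex subdifferential; $\operatorname{Prox}_f=(\mathrm{Id}+\partial f)^{-1}$ is the (single-valued) proximal mapping of $f\in\Gamma_0(X)$. The vector $d_f$: for $f\in\Gamma_0(X)$ with $Y\cap\operatorname{dom}f^*\ne\varnothing$, there is a unique pair $(e,d)\in Y\times Y$ such that $d=Se\in\operatorname{dom}f^*$, $e=Qd$, and $f^*(Se)+\langle y-Se,e\rangle-f^*(y)\le0$ for all $y\in Y$; it is denoted $(e_f,d_f)$. *)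

(* Defs.v *)
From HB Require Import structures.
From mathcomp Require Import all_boot all_order all_algebra.
From mathcomp Require Import all_classical all_reals all_analysis.

Set Implicit Arguments.
Unset Strict Implicit.
Unset Printing Implicit Defensive.

Import Order.TTheory GRing.Theory Num.Theory.
Import numFieldNormedType.Exports.

Local Open Scope classical_set_scope.
Local Open Scope ring_scope.

(* A real Hilbert space is a complete normed space X together with a dot
   product ip (symmetric bilinear positive definite form) inducing its norm. *)
Definition induces_norm (K : realType) (X : completeNormedModType K)
    (ip : {dot X for idfun}) : Prop :=
  forall x : X, `|x| = Num.sqrt (ip x x).

Definition orthogonal_complement (K : realType) (X : lmodType K)
    (ip : {dot X for idfun}) (A : set X) : set X :=
  [set y | forall x, A x -> ip x y = 0].

Section extended_real_functions.
Context {K : realType} {X : completeNormedModType K}.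
Implicit Types (ip : {dot X for idfun}) (f : X -> \bar K).
Local Open Scope ereal_scope.

Definition edom f : set X := [set x | f x < +oo].

Definition proper f : Prop := (forall x, -oo < f x) /\ edom f !=set0.

(* The weights are in the open interval so that no product 0 * +oo occurs. *)
Definition econvex f : Prop :=
  forall (x y : X) (t : K), (0 < t)%R -> (t < 1)%R ->
    f (t *: x + (1 - t) *: y)%R <= t%:E * f x + (1 - t)%:E * f y.

Definition Gamma0 : set (X -> \bar K) :=
  [set f | [/\ proper f, lower_semicontinuous f & econvex f]].

Definition conjugate ip f (u : X) : \bar K :=
  ereal_sup [set (ip x u)%:E - f x | x in [set: X]].

Definition argmin f : set X := [set z | forall x, f z <= f x].

Definition subdifferential ip f (x : X) : set X :=
  [set u | forall y, (ip (y - x)%R u)%:E + f x <= f y].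

(* For f in Gamma0 there is exactly one p with x \in p + subdifferential ip f p,
   so the default value of xget is irrelevant. *)
Definition prox ip f (x : X) : X :=
  xget 0%R [set p | [set (p + u)%R | u in subdifferential ip f p] x].

End extended_real_functions.

Section isometry_of_finite_order.
Context {K : realType} {X : completeNormedModType K}.
Variables (ip : {dot X for idfun}) (m : nat) (R : {linear X -> X}).

Definition Fix : set X := [set x | R x = x].

Definition Y : set X := orthogonal_complement ip Fix.

Definition S (x : X) : X := R x - x.

Definition Q (x : X) : X :=
  m%:R^-1 *: \sum_(1 <= i < m) i%:R *: iter i R x.

Definition is_ed_pair (f : X -> \bar K) (p : X * X) : Prop :=
  let: (e, d) := p in
  [/\ Y e /\ Y d,
      d = S e,
      edom (conjugate ip f) d,
      e = Q d
    & forall y, Y y ->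
        (conjugate ip f (S e) + (ip (y - S e) e)%:E - conjugate ip f y <= 0)%E].

(* is_ed_pair f has exactly one solution when f is in Gamma0 and Y meets the
   domain of its conjugate, so the default value of xget is irrelevant. *)
Definition ed_pair (f : X -> \bar K) : X * X := xget (0, 0) (is_ed_pair f).

Definition d_vec (f : X -> \bar K) : X := (ed_pair f).2.

End isometry_of_finite_order.

(* Main.v *)
Require Import Defs.
From mathcomp Require Import all_boot all_order all_algebra.
From mathcomp Require Import all_classical all_reals all_analysis.
From mathcomp Require Import lra.

(** Since [R] is a linear isometry, [ip x (S R x) = - 2^-1 * `|S R x| ^+ 2]
  for every [x] ([ip_isometryB]).  This one identity drives the whole proof.

  It turns the second statement into the equality case
  [conjugate ip f (S R z) + f z = ip z (S R z)] of the Fenchel-Young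
  inequality, which says that [S R z] is a subgradient of [f] at [z]
  ([subdifferentialP]); and that is the first statement, because
  [R z = z + S R z] and the resolvent of the monotone operator
  [subdifferential ip f] is single-valued ([subdifferential_prox]).

  For the third statement, [Q (S R z) = z - P z], where [P] averages over the
  orbits of [R] and hence takes values in [Fix R] ([Q_S]).  Let
  [e = Q (S R z)], so that [S R e = S R z], and [e] and [z] have the same inner
  product with every element of [Y].

  If [S R z] is a subgradient of [f] at [z], then Fenchel-Young at
  [y] in [Y], with equality at [S R z], is exactly the inequality required of
  [(e, S R z)] in the definition of the pair [(e_f, d_f)] ([is_ed_pair_S]).
  Such a pair is unique: adding the inequalities of two of them, tested against
  each other, gives [0 <= ip (e' - e) (S R (e' - e))], and by the identity above
  the right-hand side is nonpositive ([is_ed_pair_inj]).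

  Conversely, if [S R z = d_f], then the inequality of the pair at [y = 0], where
  [conjugate ip f 0 = - f z] since [z] minimizes [f], is one half of the second
  statement; the other half is Fenchel-Young ([is_ed_pair_subdifferential]). *)

Set Implicit Arguments.
Unset Strict Implicit.

Import Order.TTheory GRing.Theory Num.Theory.
Import numFieldNormedType.Exports.

Local Open Scope classical_set_scope.
Local Open Scope ring_scope.

(** * Inner products and isometries *)

Section inner_product.
Context (K : realType) (X : completeNormedModType K) (ip : {dot X for idfun}).

(** The bilinearity rules are restated so that the terms they produce mention
  [ip] through the same coercion as the statements do; the generic ones go
  through its bilinear structure, which [lra] and rewriting keep apart. *)
Lemma ipDl x y u : ip (x + y) u = ip x u + ip y u.
Proof. exact: linearDl. Qed.

Lemma ipDr x y u : ip u (x + y) = ip u x + ip u y.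
Proof. exact: linearDr. Qed.

Lemma ipBl x y u : ip (x - y) u = ip x u - ip y u.
Proof. exact: linearBl. Qed.

Lemma ipBr x y u : ip u (x - y) = ip u x - ip u y.
Proof. exact: linearBr. Qed.

Lemma ipNl x u : ip (- x) u = - ip x u.
Proof. exact: linearNl. Qed.

Lemma ipNr x u : ip u (- x) = - ip u x.
Proof. exact: linearNr. Qed.

Lemma ip0l u : ip 0 u = 0.
Proof. exact: linear0l. Qed.

Lemma ip0r u : ip u 0 = 0.
Proof. exact: linear0r. Qed.

Lemma ipZr a x u : ip u (a *: x) = a * ip u x.
Proof. exact: linearZr_LR. Qed.

Lemma ip_sumr I (r : seq I) (P : pred I) E u :
  ip u (\sum_(i <- r | P i) E i) = \sum_(i <- r | P i) ip u (E i).
Proof. exact: linear_sumr. Qed.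

Lemma ipC x y : ip x y = ip y x.
Proof. by rewrite hermC expr0 mul1r. Qed.

Lemma ip_ge0 x : 0 <= ip x x.
Proof.
have [->|x0] := eqVneq x 0; first by rewrite ip0l.
exact/ltW/neq0_dnorm_gt0.
Qed.

Lemma ip_le0_eq0 x : ip x x <= 0 -> x = 0.
Proof.
move=> x0; apply/eqP; apply: contraLR x0 => x0.
by rewrite -ltNge neq0_dnorm_gt0.
Qed.

Lemma ip_sqrnorm (ip_norm : induces_norm ip) x : ip x x = `|x| ^+ 2.
Proof. by rewrite ip_norm sqr_sqrtr// ip_ge0. Qed.

Variable R : {linear X -> X}.
Hypothesis ip_norm : induces_norm ip.
Hypothesis R_isometry : forall x, `|R x| = `|x|.

(** Polarization. *)
Lemma isometry_ip x y : ip (R x) (R y) = ip x y.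
Proof.
have Rsqr u : ip (R u) (R u) = ip u u by rewrite !ip_sqrnorm// R_isometry.
have := Rsqr (x + y).
rewrite (linearD R) !ipDl !ipDr !Rsqr (ipC (R y)) (ipC y).
lra.
Qed.

(** Expand [`|R x - x| ^+ 2] using [`|R x| = `|x|].  In particular [S R] is
  negative, and [ip x (S R x)] vanishes only if [S R x] does. *)
Lemma ip_isometryB x : ip x (S R x) = - (2^-1 * `|S R x| ^+ 2).
Proof.
rewrite -ip_sqrnorm// /S ipBl !ipBr isometry_ip (ipC (R x)).
lra.
Qed.

Lemma ip_Fix_iter (m : nat) x y : Fix R x -> ip x (iter m R y) = ip x y.
Proof. by move=> Rx; elim: m => //= m IHm; rewrite -{1}Rx isometry_ip. Qed.

Lemma Y_S x : Y ip R (S R x).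
Proof. by move=> a Ra; rewrite ipBr (ip_Fix_iter 1)// subrr. Qed.

Lemma Y_Q m x : Y ip R x -> Y ip R (Q m R x).
Proof.
move=> Yx a Ra; rewrite ipZr ip_sumr big1 ?mulr0// => i _.
by rewrite ipZr ip_Fix_iter// Yx// mulr0.
Qed.

End inner_product.

(** * The operator Q as an inverse of S *)

Section orbit_average.
Context (K : realType) (X : completeNormedModType K) (R : {linear X -> X}).
Variable m : nat.
Hypothesis R_order : forall x, iter m R x = x.

Definition orbit_average (x : X) : X := m%:R^-1 *: \sum_(0 <= i < m) iter i R x.

Lemma sum_orbit_shift x :
  \sum_(0 <= i < m) iter i.+1 R x = \sum_(0 <= i < m) iter i R x.
Proof.
apply/eqP; rewrite -subr_eq0 -sumrB.
by rewrite (telescope_sumr (fun i => iter i R x))// R_order subrr.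
Qed.

Lemma Fix_orbit_average x : Fix R (orbit_average x).
Proof.
by rewrite /Fix/= /orbit_average linearZ/= raddf_sum/= sum_orbit_shift.
Qed.

Lemma iter_S i x : iter i R (S R x) = iter i.+1 R x - iter i R x.
Proof. by elim: i => //= i ->; rewrite raddfB. Qed.

(** Thus [Q] inverts [S] modulo [Fix R].  The reason is Abel summation of
  [\sum_(i < m) i (R^(i+1) - R^i)]: the boundary term is [m R^m = m], and the
  remaining sum runs over a whole orbit. *)
Lemma Q_S x : (0 < m)%N -> Q m R (S R x) = x - orbit_average x.
Proof.
move=> m_gt0.
have m0 : m%:R != 0 :> K by rewrite pnatr_eq0 -lt0n.
have -> : Q m R (S R x) =
    m%:R^-1 *: \sum_(0 <= i < m) i%:R *: iter i R (S R x).
  by rewrite /Q [in RHS]big_ltn// scale0r add0r.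
have -> : \sum_(0 <= i < m) i%:R *: iter i R (S R x) =
    \sum_(0 <= i < m) ((i.+1%:R *: iter i.+1 R x - i%:R *: iter i R x)
                       - iter i.+1 R x).
  apply: eq_bigr => i _.
  by rewrite iter_S scalerBr -natr1 scalerDl scale1r addrAC addrK.
rewrite sumrB (telescope_sumr (fun i => i%:R *: iter i R x))//.
rewrite scale0r subr0 R_order sum_orbit_shift.
by rewrite scalerBr scalerA mulVf// scale1r.
Qed.

Lemma S_Q_S x : (0 < m)%N -> S R (Q m R (S R x)) = S R x.
Proof.
move=> m_gt0; rewrite Q_S// {1}/S (linearB R) Fix_orbit_average.
by rewrite opprB addrA subrK.
Qed.

(** An element of [Y] does not see the component of [x] in [Fix R], which is
  all that [Q m R (S R x)] loses. *)
Lemma ip_Y_Q_S (ip : {dot X for idfun}) x y :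
  (0 < m)%N -> Y ip R y -> ip y (Q m R (S R x)) = ip y x.
Proof.
move=> m_gt0 Yy; rewrite Q_S// ipBr (ipC ip y (orbit_average x)).
by rewrite Yy ?subr0//; exact: Fix_orbit_average.
Qed.

End orbit_average.

(** * Subgradients and Fenchel-Young *)

Section subgradients.
Context (K : realType) (X : completeNormedModType K) (ip : {dot X for idfun}).
Context (f : X -> \bar K).
Hypothesis f_proper : Defs.proper f.
Local Open Scope ereal_scope.

Lemma edom_fin_num x : edom f x -> f x \is a fin_num.
Proof. by move=> fx; rewrite fin_numElt f_proper.1. Qed.

Lemma argmin_edom z : argmin f z -> edom f z.
Proof. by move=> fz; have [_ [x fx]] := f_proper; exact: le_lt_trans fx. Qed.

Lemma argmin_subdifferential0 z : argmin f z -> subdifferential ip f z 0%R.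
Proof. by move=> fz y; rewrite ip0r add0e. Qed.

Lemma fenchel_young x u : edom f x -> (ip x u)%:E <= conjugate ip f u + f x.
Proof.
move=> fx; rewrite -leeBlDr ?edom_fin_num//.
by apply: ereal_sup_ubound; exists x.
Qed.

Lemma conjugate_gtNy u : -oo < conjugate ip f u.
Proof.
have [_ [x fx]] := f_proper.
have := fenchel_young u fx; rewrite -(fineK (edom_fin_num fx)).
by case: (conjugate ip f u) => [r _||//]; rewrite ?ltNyr.
Qed.

Lemma conjugate_fin_num u :
  edom (conjugate ip f) u -> conjugate ip f u \is a fin_num.
Proof. by move=> fu; rewrite fin_numElt conjugate_gtNy. Qed.

Lemma subdifferential_edom x u : subdifferential ip f x u -> edom f x.
Proof.
move=> xu; have [_ [y fy]] := f_proper.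
rewrite /edom/= ltey; apply/eqP => fx.
have := xu y; rewrite fx addey// leye_eq => /eqP fyy.
by rewrite /edom/= fyy in fy.
Qed.

(** As Fenchel-Young gives the reverse inequality, this is its equality case. *)
Lemma subdifferentialP x u : edom f x ->
  subdifferential ip f x u <-> conjugate ip f u + f x <= (ip x u)%:E.
Proof.
move=> fx; have fxE := fineK (edom_fin_num fx); split.
- move=> xu; rewrite -fxE -leeBrDr//; apply: ge_ereal_sup => _ [y _ <-].
  have := xu y; rewrite -fxE ipBl; move: (f_proper.1 y).
  by case: (f y) => //= [b _|_ _]; rewrite ?lee_fin -?EFinB ?lee_fin ?leNye//; lra.
- move=> xu y; have [fy|] := ltP (f y) +oo; last first.
    by rewrite leye_eq => /eqP ->; rewrite leey.
  have := fenchel_young u fy; move: xu.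
  rewrite -fxE -(fineK (edom_fin_num fy)) ipBl.
  move: (conjugate_gtNy u).
  case: (conjugate ip f u) => //= c _.
  by rewrite -!EFinD !lee_fin; lra.
Qed.

Lemma subdifferential_monotone x y u v :
  subdifferential ip f x u -> subdifferential ip f y v ->
  (0 <= ip (x - y) (u - v))%R.
Proof.
move=> xu yv; have := xu y; have := yv x.
rewrite -(fineK (edom_fin_num (subdifferential_edom xu))).
rewrite -(fineK (edom_fin_num (subdifferential_edom yv))).
by rewrite -!EFinD !lee_fin !ipBl !ipBr; lra.
Qed.

(** Only uniqueness in the definition of the proximal point is at stake here:
  the subgradient itself provides existence. *)
Lemma subdifferential_prox x z :
  subdifferential ip f z (x - z)%R -> prox ip f x = z.
Proof.
move=> zx; apply: xget_unique; first by exists (x - z)%R; rewrite // addrC subrK.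
move=> p [u pu ux]; apply/eqP; rewrite -subr_eq0; apply/eqP.
apply: (ip_le0_eq0 (ip := ip)).
have := subdifferential_monotone pu zx.
have -> : (u - (x - z) = - (p - z))%R.
  by rewrite -ux !opprB opprD addrCA; congr +%R; rewrite addrC subrK.
by rewrite ipNr oppr_ge0.
Qed.

End subgradients.

(** * The vector d of a function *)

Section ed_pairs.
Context (K : realType) (X : completeNormedModType K) (ip : {dot X for idfun}).
Context (m : nat) (R : {linear X -> X}) (f : X -> \bar K).
Hypothesis ip_norm : induces_norm ip.
Hypothesis m_gt0 : (0 < m)%N.
Hypothesis R_isometry : forall x, `|R x| = `|x|.
Hypothesis R_order : forall x, iter m R x = x.
Hypothesis f_proper : Defs.proper f.

(** Adding the inequality of each pair at the vector [d] of the other cancels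
  the conjugates and leaves [0 <= ip (e' - e) (S R (e' - e))], so that
  [S R (e' - e) = d' - d] vanishes by [ip_isometryB]. *)
Lemma is_ed_pair_inj p q :
  is_ed_pair ip m R f p -> is_ed_pair ip m R f q -> p = q.
Proof.
case: p q => [e d] [e' d'] [[_ Yd] dE fd eE ed] [[_ Yd'] d'E fd' e'E ed'].
suff dd' : d = d' by rewrite eE e'E dd'.
have := ed _ Yd'; have := ed' _ Yd; rewrite -dE -d'E.
rewrite -(fineK (conjugate_fin_num f_proper fd)).
rewrite -(fineK (conjugate_fin_num f_proper fd')).
rewrite -!EFinD !lee_fin => h h'.
have SB : S R (e' - e) = d' - d.
  by rewrite dE d'E /S (linearB R) !opprD addrACA.
apply/esym/eqP; rewrite -subr_eq0; apply/eqP.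
apply: (ip_le0_eq0 (ip := ip)).
have := ip_isometryB ip_norm R_isometry (e' - e).
rewrite SB -(ip_sqrnorm ip_norm) ipC ipBl !ipBr.
move: h h'; rewrite !ipBl; lra.
Qed.

(** Since [z] is a subgradient of the conjugate at [S R z], it satisfies the
  required inequality in place of [e]; on [Y] the two are interchangeable. *)
Lemma is_ed_pair_S z : subdifferential ip f z (S R z) ->
  is_ed_pair ip m R f (Q m R (S R z), S R z).
Proof.
move=> zSz; have fz := subdifferential_edom f_proper zSz.
have le_fSz := (subdifferentialP ip f_proper (S R z) fz).1 zSz.
have SQS := S_Q_S R_order z m_gt0.
have YSz := Y_S ip_norm R_isometry z.
split => //=.
- by split => //; exact: Y_Q.
- move: le_fSz; rewrite /edom/= -(fineK (edom_fin_num f_proper fz)).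
  by case: (conjugate ip f (S R z)) => [r _||] //; rewrite ltry.
move=> y Yy; rewrite SQS.
have -> : ip (y - S R z) (Q m R (S R z)) = ip (y - S R z) z.
  by rewrite 2!(ipBl ip y) !(ip_Y_Q_S R_order).
have := fenchel_young ip f_proper y fz; move: le_fSz.
rewrite -(fineK (edom_fin_num f_proper fz)) ipBl.
rewrite (ipC ip y) (ipC ip (S R z)).
move: (conjugate_gtNy ip f_proper y) (conjugate_gtNy ip f_proper (S R z)).
case: (conjugate ip f (S R z)) => //= a; case: (conjugate ip f y) => //= [b|] _ _; last by rewrite addeNy leNye.
by rewrite -!EFinD !lee_fin; lra.
Qed.

(** The inequality of the pair at [y = 0] bounds
  [conjugate ip f (S R z) - ip (S R z) z] by [conjugate ip f 0], which is at
  most [- f z] because [z] minimizes [f]. *)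
Lemma is_ed_pair_subdifferential z e : argmin f z ->
  is_ed_pair ip m R f (e, S R z) -> subdifferential ip f z (S R z).
Proof.
move=> z_min [[_ _] SzE fSz eE ineq].
have fz := argmin_edom f_proper z_min.
apply/subdifferentialP => //.
have Y0 : Y ip R 0 by move=> x _; rewrite ip0r.
have z0 := argmin_subdifferential0 ip z_min.
have := (subdifferentialP ip f_proper 0 fz).1 z0.
have := ineq _ Y0; rewrite -SzE sub0r ipNl ip0r eE.
rewrite (ip_Y_Q_S R_order)//; last exact: Y_S.
rewrite (ipC ip _ z).
rewrite -(fineK (edom_fin_num f_proper fz)).
rewrite -(fineK (conjugate_fin_num f_proper fSz)).
move: (conjugate_gtNy ip f_proper 0).
by case: (conjugate ip f 0) => //= b _; rewrite -!EFinD !lee_fin; lra.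
Qed.

End ed_pairs.

Theorem theorem4p10 (K : realType) (X : completeNormedModType K)
    (ip : {dot X for idfun}) (ip_norm : induces_norm ip)
    (m : nat) (m_gt0 : (0 < m)%N)
    (R : {linear X -> X}) (R_isometry : forall x, `|R x| = `|x|)
    (R_order : forall x, iter m R x = x)
    (f : X -> \bar K) (f_Gamma0 : Gamma0 f)
    (Y_dom : Y ip R `&` edom (conjugate ip f) !=set0) :
  forall z : X, argmin f z ->
    [<-> z = prox ip f (R z);
         (conjugate ip f (S R z) + (2^-1 * `|S R z| ^+ 2)%:E + f z = 0)%E;
         S R z = d_vec ip m R f].
Proof.
move=> z z_min.
have [f_proper _ _] := f_Gamma0.
have fz := argmin_edom f_proper z_min.
have fzE := fineK (edom_fin_num f_proper fz).
have ipS := ip_isometryB ip_norm R_isometry z.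
have subP : subdifferential ip f z (S R z) <->
    (conjugate ip f (S R z) + (2^-1 * `|S R z| ^+ 2)%:E + f z = 0)%E.
  have := fenchel_young ip f_proper (S R z) fz.
  rewrite subdifferentialP// -fzE ipS.
  move: (conjugate_gtNy ip f_proper (S R z)).
  case: (conjugate ip f (S R z)) => //= a _; rewrite -!EFinD !lee_fin => h.
  by split => [h'|[]]; [congr (_%:E)|]; lra.
tfae.
- move=> zE; apply/subP; move: zE; rewrite /prox.
  case: xgetP => [p _ [u pu uE] zp|noP z0].
    by rewrite /S -uE zp addrAC subrr add0r.
  (* If no proximal point existed, the default value would give z = 0 = R z,
     and z would be a proximal point of R z after all. *)
  exfalso; apply: (noP z); exists 0; first exact: argmin_subdifferential0.
  by rewrite addr0 z0 raddf0.
- move=> /subP zSz; rewrite /d_vec /ed_pair.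
  have ed := is_ed_pair_S ip_norm m_gt0 R_isometry R_order f_proper zSz.
  rewrite (xget_unique _ ed)// => q edq.
  by apply: (is_ed_pair_inj ip_norm R_isometry f_proper edq ed).
- move=> Sz; apply/esym/subdifferential_prox => //; rewrite -/(S R z).
  move: Sz; rewrite /d_vec /ed_pair.
  (* Without a pair, [d_vec] would be 0, and then S R z = 0 is a subgradient
     at the minimizer z. *)
  case: xgetP => [[e d] _ ed Sz|_ ->]; last exact: argmin_subdifferential0.
  apply: (is_ed_pair_subdifferential ip_norm m_gt0 R_isometry R_order f_proper
    z_min (e := e)).
  by rewrite Sz.
Qed.
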